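(* Let $n\ge1$, let $B$ be a Boolean algebra and $h$ a function from the lattice $Div(n)$ of positive divisors of $n$ into the lattice of filters of $B$ such that $h(n)=\{1\}$ and $h(\gcd\{d,r\})=h(d)\vee h(r)$ for all $d,r\in Div(n)$ (so $\langle B,h\rangle\in B^{n+1}$). Let $A=M(B,h)$. Then $\langle B,h\rangle$ and $\langle B(A),h_A\rangle$ are isomorphic, i.e. there is a Boolean isomorphism $\mu:B\to B(A)$ with $\mu^{-1}(h_A(d))=h(d)$ for every $d\in Div(n)$.
   Context: $h(d)\vee h(r)$ denotes the join (generated filter) in the lattice of filters of $B$. $B^{[n]}$ is the set of increasing functions $f:\{1,\ldots,n\}\to B$; for $d\in Div(n)$, $1\le q\le d$, $\xi_{d,q}(f)=\neg f(q\frac nd)\vee f((q-1)\frac nd+1)$; $M(B,h)=\{f\in B^{[n]}:\xi_{d,q}(f)\in h(d)\ \forall d, q\}$, which is a Wajsberg algebra under $\mathbb I$ (constant $1$), $(\neg f)(k)=\neg f(n+1-k)$, $(f\Rightarrow g)(k)=\bigwedge_{i=1}^{n-k+1}(\neg f(i)\vee g(i+k-1))$. For a Wajsberg algebra $A$ (algebra $\langle A,\to,\neg,1\rangle$ with $1\to x=x$, $(x\to y)\to((y\to z)\to(x\to z))=1$, $(x\to y)\to y=(y\to x)\to x$, $(\neg y\to\neg x)\to(x\to y)=1$, and $x\odot y=\neg(x\to\neg y)$), $B(A)=\{x\in A:x\odot x=x\}$ is its maximal Boolean subalgebra. An implicative filter of $A$ is a set $F\ni1$ closed under modus ponens ($a,a\to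 b\in F\Rightarrow b\in F$); $\chi(A)$ is the set of prime implicative filters (those $P$ with $A/P$ a chain). $L_{d+1}=\{0,\frac1d,\ldots,1\}$ with $x\to y=\min\{1,1-x+y\}$, $\neg x=1-x$. For $d\in Div(n)$, $P_d=\bigcap\{P\in\chi(A):A/P$ embeds in $L_{d+1}\}$ and $h_A(d)=P_d\cap B(A)$. *)

(* Defs.v *)
From HB Require Import structures.
From mathcomp Require Import all_boot all_order all_algebra.
From mathcomp Require Import zify ring lra.
From mathcomp Require Import boolp classical_sets functions.

Set Implicit Arguments.
Unset Strict Implicit.
Unset Printing Implicit Defensive.

Import Order.TTheory Order.CTheory GRing.Theory Num.Theory.

Declare Scope wajsberg_scope.
Delimit Scope wajsberg_scope with W.
Reserved Notation "x ==>> y" (at level 55, right associativity).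

HB.mixin Record isWajsberg T of Choice T := {
  wimp : T -> T -> T;
  wneg : T -> T;
  wone : T;
  wimp1x : forall x, wimp wone x = x;
  wimpT : forall x y z,
    wimp (wimp x y) (wimp (wimp y z) (wimp x z)) = wone;
  wimpC : forall x y, wimp (wimp x y) y = wimp (wimp y x) x;
  wimpN : forall x y, wimp (wimp (wneg y) (wneg x)) (wimp x y) = wone
}.

#[short(type="wajsbergType")]
HB.structure Definition Wajsberg := {T of isWajsberg T & Choice T}.

Arguments wone {s}.
Notation "x ==>> y" := (wimp x y) : wajsberg_scope.
Local Open Scope wajsberg_scope.

Section WajsbergOperations.
Variable A : wajsbergType.
Implicit Types x y : A.

Definition wle x y : Prop := x ==>> y = wone.
Definition wzero : A := wneg wone.
Definition wodot x y : A := wneg (x ==>> wneg y).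
Definition wjoin x y : A := (x ==>> y) ==>> y.
Definition wmeet x y : A := wneg (wjoin (wneg x) (wneg y)).

Definition is_chain : Prop := forall x y, wle x y \/ wle y x.

(* The paper's B(A), carrying the operations of A. *)
Definition boolean_center : set A := [set x | wodot x x = x]%classic.

End WajsbergOperations.

Arguments boolean_center : clear implicits.

Definition wembeds (A C : wajsbergType) : Prop :=
  exists phi : A -> C,
    [/\ injective phi,
        phi wone = wone,
        forall x, phi (wneg x) = wneg (phi x) &
        forall x y, phi (x ==>> y) = phi x ==>> phi y].

Section WajsbergTheory.
Variable A : wajsbergType.
Implicit Types x y z : A.

Lemma wimpxx x : x ==>> x = wone.
Proof. by have := wimpT wone wone x; rewrite !wimp1x. Qed.

Lemma wimpx1 x : x ==>> wone = wone.
Proof.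
have E : (x ==>> wone) ==>> wone = wone by rewrite wimpC wimp1x wimpxx.
by have := wimpT wone x wone; rewrite !wimp1x E.
Qed.

Lemma wle_anti x y : wle x y -> wle y x -> x = y.
Proof. by move=> xy yx; have := wimpC x y; rewrite xy yx !wimp1x. Qed.

Lemma wle_trans y x z : wle x y -> wle y z -> wle x z.
Proof. by move=> xy yz; have := wimpT x y z; rewrite xy yz !wimp1x. Qed.

Lemma wle_imp2r x y z : wle x y -> wle (y ==>> z) (x ==>> z).
Proof. by move=> xy; have := wimpT x y z; rewrite xy wimp1x. Qed.

Lemma wimpK x y : wle x (y ==>> x).
Proof. by have := wimpT y wone x; rewrite wimpx1 !wimp1x. Qed.

Lemma wimp_mp x y : wle x ((x ==>> y) ==>> y).
Proof. by rewrite wimpC; apply: wimpK. Qed.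

Lemma wimp_exch x y z : x ==>> y ==>> z = y ==>> x ==>> z.
Proof.
suff le (u v w : A) : wle (u ==>> v ==>> w) (v ==>> u ==>> w) by exact: wle_anti.
have le := wle_imp2r (u ==>> w) (wimp_mp v w).
exact: wle_trans (wimpT _ _ _) le.
Qed.

Lemma wimpT2 x y z : (y ==>> z) ==>> (x ==>> y) ==>> x ==>> z = wone.
Proof. by rewrite wimp_exch wimpT. Qed.

Lemma wle0x x : wle (wzero A) x.
Proof.
apply: wle_trans (wimpK _ (wneg x)) _.
by have := wimpN wone x; rewrite wimp1x.
Qed.

Lemma wnegE x : wneg x = x ==>> wzero A.
Proof.
apply: wle_anti.
  by apply: wle_trans (wimpK _ (wneg (wzero A))) _; apply: wimpN.
have le : wle (wneg x ==>> wzero A) x by have := wimpN wone x; rewrite wimp1x.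
have := wle_imp2r (wzero A) le.
by rewrite (wimpC (wneg x)) wle0x wimp1x.
Qed.

End WajsbergTheory.

Record impl_filter (A : wajsbergType) := ImplFilter {
  impl_filter_set :> A -> Prop;
  impl_filter1 : impl_filter_set wone;
  impl_filter_mp : forall a b,
    impl_filter_set a -> impl_filter_set (a ==>> b) -> impl_filter_set b
}.

Section Quotient.
Variables (A : wajsbergType) (P : impl_filter A).
Local Open Scope quotient_scope.
Implicit Types x y z : A.

Definition wcong x y : bool := `[< P (x ==>> y) /\ P (y ==>> x) >].

Let Ple x y : wle x y -> P x -> P y.
Proof. by move=> xy Px; apply: (impl_filter_mp Px); rewrite xy; apply: impl_filter1. Qed.

Let PT x y z : P (x ==>> y) -> P (y ==>> z) -> P (x ==>> z).
Proof. by move=> xy yz; apply: (impl_filter_mp yz); apply: (Ple _ xy); apply: wimpT. Qed.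

Lemma wcong_equiv : equiv_class_of wcong.
Proof.
split=> [x|x y|y x z]; first by apply/asboolP; rewrite wimpxx; split; apply: impl_filter1.
  by rewrite /wcong; congr asbool; apply/propext; split=> -[].
move=> /asboolP[xy yx] /asboolP[yz zy]; apply/asboolP.
by split; [apply: (PT xy) | apply: (PT zy)].
Qed.

Canonical wcong_rel := EquivRelPack wcong_equiv.

Definition wquot := {eq_quot wcong}%qT.
HB.instance Definition _ := Choice.on wquot.
HB.instance Definition _ := EqQuotient.on wquot.

Definition wquot_imp (X Y : wquot) : wquot := \pi_wquot (repr X ==>> repr Y)%W.
Definition wquot_neg (X : wquot) : wquot := \pi_wquot (wneg (repr X)).
Definition wquot_one : wquot := \pi_wquot wone.

Lemma wquot_eqP x y :
  \pi_wquot x = \pi_wquot y <-> P (x ==>> y) /\ P (y ==>> x).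
Proof. by split=> [/eqmodP/asboolP|H]; last by apply/eqmodP/asboolP. Qed.

Lemma wquot_impE x y : wquot_imp (\pi_wquot x) (\pi_wquot y) = \pi_wquot (x ==>> y)%W.
Proof.
rewrite /wquot_imp; set x' := repr _; set y' := repr _.
have /wquot_eqP[xx' x'x] : \pi_wquot x = \pi_wquot x' by rewrite reprK.
have /wquot_eqP[yy' y'y] : \pi_wquot y = \pi_wquot y' by rewrite reprK.
apply/wquot_eqP; split.
  by apply: PT (Ple (wimpT _ _ _) xx') (Ple (wimpT2 _ _ _) y'y).
by apply: PT (Ple (wimpT _ _ _) x'x) (Ple (wimpT2 _ _ _) yy').
Qed.

Lemma wquot_negE x : wquot_neg (\pi_wquot x) = \pi_wquot (wneg x).
Proof. by rewrite wnegE -wquot_impE /wquot_neg wnegE -wquot_impE reprK. Qed.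

Let quot1 (X : wquot) : wquot_imp wquot_one X = X.
Proof. by elim/quotW: X => x; rewrite wquot_impE wimp1x. Qed.
Let quotT (X Y Z : wquot) : wquot_imp (wquot_imp X Y)
  (wquot_imp (wquot_imp Y Z) (wquot_imp X Z)) = wquot_one.
Proof.
elim/quotW: X => x; elim/quotW: Y => y; elim/quotW: Z => z.
by rewrite /wquot_one -(wimpT x y z) -!wquot_impE.
Qed.
Let quotC (X Y : wquot) :
  wquot_imp (wquot_imp X Y) Y = wquot_imp (wquot_imp Y X) X.
Proof.
elim/quotW: X => x; elim/quotW: Y => y.
by have := congr1 (\pi_wquot) (wimpC x y); rewrite -!wquot_impE.
Qed.
Let quotN (X Y : wquot) : wquot_imp
  (wquot_imp (wquot_neg Y) (wquot_neg X)) (wquot_imp X Y) = wquot_one.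
Proof.
elim/quotW: X => x; elim/quotW: Y => y.
by rewrite /wquot_one -(wimpN x y) -!wquot_impE -!wquot_negE.
Qed.

HB.instance Definition _ := isWajsberg.Build wquot quot1 quotT quotC quotN.

Definition is_prime : Prop := is_chain wquot.

End Quotient.

Section LukasiewiczChain.
Variable d : nat.
Local Open Scope ring_scope.

(* For d > 0 this is {0, 1/d, ..., 1}, see lukP; the present form is closed *)
(* under the operations for d = 0 as well. *)
Definition in_luk (x : rat) : bool :=
  (0 <= x <= 1) && (x * d%:R \is a Num.int).

Lemma lukP (x : rat) : (0 < d)%N ->
  in_luk x <-> exists2 k : nat, (k <= d)%N & x = k%:R / d%:R.
Proof.
move=> d0; have dP : 0 < d%:R :> rat by rewrite ltr0n.
split=> [/andP[/andP[x0 x1]] xd|[k kd ->]].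
  have: x * d%:R \is a Num.nat by rewrite natrEint xd mulr_ge0 // ltW.
  move/natrP => [k Ek]; exists k.
    by rewrite -(ler_nat rat) -Ek ler_piMl // ltW.
  by rewrite -Ek mulfK // gt_eqF.
rewrite /in_luk divr_ge0 ?ler0n //= ler_pdivrMr // mul1r ler_nat kd /=.
by rewrite divfK ?gt_eqF.
Qed.

Definition luk := {x : rat | in_luk x}.
HB.instance Definition _ := Choice.on luk.

Lemma luk_imp_subproof (x y : luk) : in_luk (Num.min 1 (1 - val x + val y)).
Proof.
case: x y => [x /andP[/andP[x0 x1] xd]] [y /andP[/andP[y0 y1] yd]] /=.
rewrite /in_luk le_min ge_min lexx ler01 /= (_ : 0 <= 1 - x + y) /=; last by lra.
case: leP => _; first by rewrite mul1r.
by rewrite mulrDl mulrBl mul1r; apply: rpredD => //; apply: rpredB; rewrite ?rpred_nat.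
Qed.

Lemma luk_neg_subproof (x : luk) : in_luk (1 - val x).
Proof.
case: x => [x /andP[/andP[x0 x1] xd]] /=; apply/andP; split; first by lra.
by rewrite mulrBl mul1r; apply: rpredB; rewrite ?rpred_nat.
Qed.

Lemma luk_one_subproof : in_luk 1.
Proof. by rewrite /in_luk ler01 lexx mul1r rpred_nat. Qed.

Definition luk_imp (x y : luk) : luk := Sub _ (luk_imp_subproof x y).
Definition luk_neg (x : luk) : luk := Sub _ (luk_neg_subproof x).
Definition luk_one : luk := Sub _ luk_one_subproof.

Let luk_bounds (x : luk) : 0 <= val x <= 1.
Proof. by have /andP[] := valP x. Qed.

Let luk1 (x : luk) : luk_imp luk_one x = x.
Proof.
apply/val_inj => /=; move: (luk_bounds x); case: x => x _ /=.
by rewrite /Num.min; case: ifPn; lra.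
Qed.
Let lukT (x y z : luk) :
  luk_imp (luk_imp x y) (luk_imp (luk_imp y z) (luk_imp x z)) = luk_one.
Proof.
apply/val_inj => /=; move: (luk_bounds x) (luk_bounds y) (luk_bounds z).
case: x y z => [x _] [y _] [z _] /=.
by rewrite /Num.min; do !case: ifPn; lra.
Qed.
Let lukC (x y : luk) : luk_imp (luk_imp x y) y = luk_imp (luk_imp y x) x.
Proof.
apply/val_inj => /=; move: (luk_bounds x) (luk_bounds y).
case: x y => [x _] [y _] /=.
by rewrite /Num.min; do !case: ifPn; lra.
Qed.
Let lukN (x y : luk) :
  luk_imp (luk_imp (luk_neg y) (luk_neg x)) (luk_imp x y) = luk_one.
Proof.
apply/val_inj => /=; move: (luk_bounds x) (luk_bounds y).
case: x y => [x _] [y _] /=.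
by rewrite /Num.min; do !case: ifPn; lra.
Qed.

HB.instance Definition _ := isWajsberg.Build luk luk1 lukT lukC lukN.

End LukasiewiczChain.

Section AssociatedPair.
Variable A : wajsbergType.
Local Open Scope classical_set_scope.

Definition P_ (d : nat) : set A :=
  [set x | forall P : impl_filter A,
     is_prime P -> wembeds (wquot P) (luk d) -> P x].

Definition hA (d : nat) : set A := P_ d `&` boolean_center A.

End AssociatedPair.

Arguments P_ : clear implicits.
Arguments hA : clear implicits.

Local Open Scope order_scope.

Record bfilter (disp : Order.disp_t) (B : ctbDistrLatticeType disp) := BFilter {
  bfilter_set :> B -> Prop;
  bfilter1 : bfilter_set \top;
  bfilter_up : forall x y, x <= y -> bfilter_set x -> bfilter_set y;
  bfilterI : forall x y, bfilter_set x -> bfilter_set y -> bfilter_set (x `&` y)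
}.

Section BooleanFilters.
Variables (disp : Order.disp_t) (B : ctbDistrLatticeType disp).
Implicit Types (x y : B) (F G : bfilter B).

Definition bfilter_gen_set (S : set B) : B -> Prop :=
  fun x => forall F, (forall y, S y -> F y) -> F x.

Lemma bfilter_gen1 S : bfilter_gen_set S \top.
Proof. by move=> F _; apply: bfilter1. Qed.

Lemma bfilter_gen_up S x y :
  x <= y -> bfilter_gen_set S x -> bfilter_gen_set S y.
Proof. by move=> xy Sx F SF; apply: bfilter_up xy (Sx F SF). Qed.

Lemma bfilter_genI S x y :
  bfilter_gen_set S x -> bfilter_gen_set S y -> bfilter_gen_set S (x `&` y).
Proof. by move=> Sx Sy F SF; apply: bfilterI (Sx F SF) (Sy F SF). Qed.

Definition bfilter_gen (S : set B) : bfilter B :=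
  BFilter (@bfilter_gen1 S) (@bfilter_gen_up S) (@bfilter_genI S).

Definition bfilter_join F G : bfilter B :=
  bfilter_gen (bfilter_set F `|` bfilter_set G)%classic.

Definition is_bval (v : B -> bool) : Prop :=
  [/\ v \top, forall x y, v (x `&` y) = v x && v y &
      forall x, v (~` x) = ~~ v x].

(* Boolean prime ideal theorem, for filters. *)
Lemma bval_exists F x : ~ F x ->
  exists v, [/\ is_bval v, forall y, F y -> v y & ~~ v x].
Proof.
move=> Fx.
pose ok (U : set B) := [/\ U \top, forall y z, y <= z -> U y -> U z,
  forall y z, U y -> U z -> U (y `&` z) & ~ U x].
pose ext (G : set B) := (bfilter_set F `|` G)%classic.
have [] := @Zorn_bigcup _ [set G | ok (ext G)]%classic.
  move=> C Cok Ctot; split.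
  - by left; apply: bfilter1.
  - move=> y z yz [Fy|[G CG Gy]]; first by left; apply: bfilter_up Fy.
    by have [_ up _ _] := Cok _ CG;
      case: (up _ _ yz (or_intror Gy)) => ?; [left|right; exists G].
  - move=> y z [Fy|[G CG Gy]] [Fz|[H CH Hz]].
    + by left; apply: bfilterI.
    + have [_ _ I _] := Cok _ CH.
      by case: (I y z (or_introl Fy) (or_intror Hz)) => ?; [left|right; exists H].
    + have [_ _ I _] := Cok _ CG.
      by case: (I y z (or_intror Gy) (or_introl Fz)) => ?; [left|right; exists G].
    + have [GH|HG] := Ctot _ _ CG CH.
        have [_ _ I _] := Cok _ CH.
        by case: (I y z (or_intror (GH _ Gy)) (or_intror Hz)) => ?;
          [left|right; exists H].
      have [_ _ I _] := Cok _ CG.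
      by case: (I y z (or_intror Gy) (or_intror (HG _ Hz))) => ?;
        [left|right; exists G].
  - by move=> [//|[G CG Gx]]; have [_ _ _ []] := Cok _ CG; right.
move=> G0 [+ Gmax]; rewrite /= => -[].
set U := ext G0 => U1 Uup UI Ux.
have FU y : F y -> U y by left.
have step y : ~ U y -> exists2 u, U u & u `&` y <= x.
  move=> Uy; apply: contrapT => /forall2NP noU.
  pose H : set B := fun z => exists2 u, U u & u `&` y <= z.
  have FH z : F z -> H z.
    by move=> Fz; exists z; [left|apply: leIl].
  have EH : ext H = H by apply/seteqP; split=> z; [case=> // /FH|right].
  apply: (Gmax H); last first.
    rewrite /= EH; split.
    - by apply/FH/bfilter1.
    - by move=> z t zt [u Uu uz]; exists u => //; apply: le_trans zt.
    - move=> z t [u Uu uz] [w Uw wt]; exists (u `&` w); first exact: UI.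
      rewrite lexI (le_trans _ uz) ?(le_trans _ wt) //.
        by rewrite leI2 // leIr.
      by rewrite leI2 // leIl.
    - by move=> [u Uu ux]; case: (noU u).
  split=> [z Gz|]; first by exists z; [right|apply: leIl].
  move=> HG; apply: Uy; right; apply: HG.
  by exists \top => //; rewrite meet1x.
have Uor y : U y \/ U (~` y).
  apply: contrapT => /not_orP[/step[u Uu uy] /step[w Ww wy]].
  apply: Ux; apply: Uup (UI _ _ Uu Ww).
  rewrite -[X in X <= _](@meetx1 _ B) -(joinxC y) meetUr leUx.
  by rewrite (le_trans _ uy) ?(le_trans _ wy) // leI2 // ?leIl ?leIr.
have Unot y : U y -> U (~` y) -> False.
  by move=> Uy Ucy; apply: Ux; apply: Uup (UI _ _ Uy Ucy); rewrite meetxC le0x.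
exists (fun y => `[< U y >]); split; first split.
- exact/asboolP.
- move=> y z; apply/asboolP/andP => [Uyz|[/asboolP Uy /asboolP Uz]].
    by split; apply/asboolP; apply: Uup Uyz; rewrite ?leIl ?leIr.
  exact: UI.
- move=> y; apply/asboolP/negP => [Ucy /asboolP Uy|nUy].
    exact: Unot Uy Ucy.
  by case: (Uor y) => // /asboolP /nUy.
- by move=> y /FU Uy; apply/asboolP.
- by apply/negP => /asboolP.
Qed.

End BooleanFilters.

Section BooleanValuations.
Variables (disp : Order.disp_t) (B : ctbDistrLatticeType disp).
Variables (v : B -> bool) (vP : is_bval v).

Lemma bvalT : v \top. Proof. by case: vP. Qed.
Lemma bvalI x y : v (x `&` y) = v x && v y. Proof. by case: vP. Qed.
Lemma bvalC x : v (~` x) = ~~ v x. Proof. by case: vP. Qed.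
Lemma bval0 : v \bot = false.
Proof. by rewrite -compl1 bvalC bvalT. Qed.
Lemma bvalU x y : v (x `|` y) = v x || v y.
Proof. by rewrite -[x `|` y]complK complU bvalC bvalI !bvalC negb_and !negbK. Qed.
Lemma bval_le x y : x <= y -> v x -> v y.
Proof. by move=> /meet_idPl <-; rewrite bvalI => /andP[]. Qed.
Lemma bval_meet (I : eqType) (r : seq I) (E : I -> B) :
  v (\meet_(i <- r) E i) = all (fun i => v (E i)) r.
Proof.
elim: r => [|i r IH]; first by rewrite big_nil bvalT.
by rewrite big_cons bvalI IH.
Qed.

End BooleanValuations.

Lemma bval_inj (disp : Order.disp_t) (B : ctbDistrLatticeType disp) (x y : B) :
  (forall v, is_bval v -> v x = v y) -> x = y.
Proof.
suff le (z t : B) : (forall v, is_bval v -> v z = v t) -> z <= t.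
  by move=> H; apply/le_anti; rewrite !le // => v /H ->.
move=> H; pose F := @bfilter_gen _ B [set z]%classic.
have Fz : F z by move=> G; apply.
apply/negPn/negP => zt.
have [|v [vP Fv]] := @bval_exists _ B F t.
  pose U (w : B) : Prop := z <= w.
  have U1 : U \top by rewrite /U lex1.
  have Uup a b : a <= b -> U a -> U b by move=> ab; rewrite /U => /le_trans; apply.
  have UI a b : U a -> U b -> U (a `&` b) by rewrite /U lexI => -> ->.
  by move=> /(_ (BFilter U1 Uup UI)) K; apply: (negP zt); apply: K => _ ->; apply: lexx.
by rewrite -H // Fv.
Qed.

Section RepresentingAlgebra.
Variables (disp : Order.disp_t) (B : ctbDistrLatticeType disp) (n : nat).
Variable h : nat -> bfilter B.
Implicit Types f g : {ffun 'I_n -> B}.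

(* The index k : 'I_n stands for the element k + 1 of {1, ..., n}; ev f k is *)
(* the value of f at k with the indexing 1 <= k <= n (junk outside). *)
Definition ev f (k : nat) : B := oapp f \bot (insub k.-1).

Definition increasing f : Prop :=
  {homo f : i j / (i <= j)%N >-> i <= j}.

Definition xi (d q : nat) f : B :=
  ~` ev f (q * (n %/ d)) `|` ev f ((q - 1) * (n %/ d) + 1).

Definition in_M f : Prop :=
  increasing f /\
  forall d q : nat, (d %| n)%N -> (1 <= q <= d)%N -> h d (xi d q f).

Definition M := {f : {ffun 'I_n -> B} | `[< in_M f >]}.
HB.instance Definition _ := Choice.on M.

Definition fone : {ffun 'I_n -> B} := [ffun=> \top].
Definition fneg f : {ffun 'I_n -> B} := [ffun k : 'I_n => ~` ev f (n + 1 - k.+1)].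
Definition fimp f g : {ffun 'I_n -> B} :=
  [ffun k : 'I_n => \meet_(1 <= i < (n - k.+1 + 1).+1)
                      (~` ev f i `|` ev g (i + k.+1 - 1))].

Lemma ev_ord f (k : 'I_n) : ev f k.+1 = f k.
Proof. by rewrite /ev /= valK. Qed.

Lemma evE f k (kn : (0 < k <= n)%N) :
  exists2 i : 'I_n, k = i.+1 & ev f k = f i.
Proof.
case: k kn => // k kn; exists (Ordinal kn) => //.
exact: (ev_ord f (Ordinal kn)).
Qed.

Definition cnt (v : B -> bool) f : nat :=
  n - find (fun k => v (ev f k.+1)) (iota 0 n).

Lemma cnt_le v f : (cnt v f <= n)%N.
Proof. exact: leq_subr. Qed.

Section Valuation.
Variables (v : B -> bool) (vP : is_bval v).

Lemma bval_ev f k : increasing f -> (0 < k <= n)%N ->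
  v (ev f k) = (n < k + cnt v f)%N.
Proof.
move=> incf kn; rewrite /cnt; set a := (fun k => _); set p := find a _.
have pn : (p <= n)%N by rewrite -[X in (_ <= X)%N](size_iota 0) find_size.
rewrite (_ : (n < k + (n - p))%N = (p < k)%N); last by lia.
apply/idP/idP => [vk|pk].
  rewrite ltnNge; apply/negP => kp.
  have kp' : (k.-1 < p)%N by lia.
  have := before_find 0 kp'; rewrite nth_iota ?add0n; last by lia.
  by rewrite /a prednK ?vk //; lia.
have hasa : has a (iota 0 n) by rewrite has_find size_iota -/p; lia.
have := nth_find 0 hasa; rewrite -/p nth_iota ?add0n; last by lia.
have [|j Ej Evj] := @evE f p.+1; first by lia.
have [|i Ei Evi] := @evE f k; first by lia.
by rewrite /a Evj Evi; apply: (bval_le vP); apply: incf; lia.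
Qed.

Lemma cnt_uniq f c : increasing f -> (c <= n)%N ->
  (forall k, (0 < k <= n)%N -> v (ev f k) = (n < k + c)%N) -> cnt v f = c.
Proof.
move=> incf cn H; have cntn := cnt_le v f.
have E k : (0 < k <= n)%N -> (n < k + cnt v f)%N = (n < k + c)%N.
  by move=> kn; rewrite -bval_ev // H.
have [lt|lt|//] := ltngtP (cnt v f) c.
  by have := E (n + 1 - c)%N; lia.
by have := E (n + 1 - cnt v f)%N; lia.
Qed.

Lemma bval_fone k : (0 < k <= n)%N -> v (ev fone k).
Proof. by move=> /(evE fone)[i _ ->]; rewrite ffunE bvalT. Qed.

Lemma bval_fneg f k : increasing f -> (0 < k <= n)%N ->
  v (ev (fneg f) k) = (n < k + (n - cnt v f))%N.
Proof.
move=> incf kn; have [i Ei ->] := evE (fneg f) kn.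
have cn := cnt_le v f.
by rewrite ffunE bvalC // -Ei bval_ev //; lia.
Qed.

Lemma bval_fimp f g k : increasing f -> increasing g -> (0 < k <= n)%N ->
  v (ev (fimp f g) k) = (n < k + minn n (n - cnt v f + cnt v g))%N.
Proof.
move=> incf incg kn; have [i Ei ->] := evE (fimp f g) kn.
rewrite ffunE bval_meet // -Ei; have fn := cnt_le v f; have gn := cnt_le v g.
apply/allP/idP => [H|H j].
  rewrite ltnNge; apply/negP => le.
  have := H (n + 1 - cnt v f)%N; rewrite mem_index_iota bvalU // bvalC //.
  have le1 : (k + cnt v g <= cnt v f)%N by lia.
  by rewrite !bval_ev //; lia.
rewrite mem_index_iota => jn; rewrite bvalU // bvalC // !bval_ev //; lia.
Qed.

End Valuation.

Lemma increasing_bval f (c : (B -> bool) -> nat) :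
  (forall v, is_bval v -> forall k, (0 < k <= n)%N ->
     v (ev f k) = (n < k + c v)%N) -> increasing f.
Proof.
move=> H i j ij; apply/meet_idPl; apply: bval_inj => v vP.
rewrite bvalI // -!ev_ord !H ?ltn_ord //; lia.
Qed.

Lemma increasing_fone : increasing fone.
Proof. by move=> i j _; rewrite !ffunE. Qed.

Lemma increasing_fneg f : increasing f -> increasing (fneg f).
Proof.
move=> incf; apply: (@increasing_bval _ (fun v => n - cnt v f)%N).
by move=> v vP k kn; apply: bval_fneg.
Qed.

Lemma increasing_fimp f g :
  increasing f -> increasing g -> increasing (fimp f g).
Proof.
move=> incf incg.
apply: (@increasing_bval _ (fun v => minn n (n - cnt v f + cnt v g))).
by move=> v vP k kn; apply: bval_fimp.
Qed.

Lemma cnt_fone v : is_bval v -> cnt v fone = n.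
Proof.
move=> vP; apply: (cnt_uniq vP increasing_fone) => // k kn.
by rewrite bval_fone //; lia.
Qed.

Lemma cnt_fneg v f : is_bval v -> increasing f ->
  cnt v (fneg f) = (n - cnt v f)%N.
Proof.
move=> vP incf; apply: (cnt_uniq vP (increasing_fneg incf)).
  exact: leq_subr.
by move=> k kn; apply: bval_fneg.
Qed.

Lemma cnt_fimp v f g : is_bval v -> increasing f -> increasing g ->
  cnt v (fimp f g) = minn n (n - cnt v f + cnt v g).
Proof.
move=> vP incf incg; apply: (cnt_uniq vP (increasing_fimp incf incg)).
  exact: geq_minl.
by move=> k kn; apply: bval_fimp.
Qed.

Lemma cnt_inj f g : increasing f -> increasing g ->
  (forall v, is_bval v -> cnt v f = cnt v g) -> f = g.
Proof.
move=> incf incg H; apply/ffunP => i; apply: bval_inj => v vP.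
by rewrite -!ev_ord !bval_ev ?ltn_ord // H.
Qed.

Lemma bval_xiP v f d : is_bval v -> increasing f -> (d %| n)%N ->
  (forall q, (1 <= q <= d)%N -> v (xi d q f)) <-> (n %/ d %| cnt v f)%N.
Proof.
move=> vP incf dn; have fn := cnt_le v f.
have [n0|n_gt0] := posnP n.
  have -> : cnt v f = 0%N by lia.
  rewrite dvdn0; split=> // _ q _; rewrite /xi bvalU // bvalC //.
  have ev0 k : ev f k = \bot by rewrite /ev insubF // n0.
  by rewrite !ev0 bval0.
have d_gt0 := dvdn_gt0 n_gt0 dn.
rewrite /xi; set m := (n %/ d)%N.
have En : n = (d * m)%N by rewrite mulnC divnK.
have m_gt0 : (0 < m)%N by rewrite divn_gt0 // dvdn_leq.
have xiE q : (1 <= q <= d)%N ->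
    v (~` ev f (q * m) `|` ev f ((q - 1) * m + 1)) =
    ((n < q * m + cnt v f) ==> (n <= (q - 1) * m + cnt v f))%N.
  move=> /andP[q0 qd]; have qn : (q * m <= n)%N by rewrite En leq_mul2r qd orbT.
  have Eq : (q * m = (q - 1) * m + m)%N by rewrite addnC -mulSn subn1 prednK.
  have qm : (0 < q * m)%N by rewrite muln_gt0 q0.
  move: (q * m)%N ((q - 1) * m)%N qn Eq qm => a b qn Eq qm.
  by rewrite bvalU // bvalC // !bval_ev //; lia.
split=> [H|/dvdnP[t Et] q qd]; last first.
  rewrite xiE // Et En -!mulnDl ltn_mul2r leq_mul2r; lia.
rewrite /dvdn; apply/negPn/negP => r0.
set c := cnt v f in fn H r0 xiE; have Ec := divn_eq c m.
set t := (c %/ m)%N in Ec; set r := (c %% m)%N in Ec r0.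
have rm : (r < m)%N by rewrite ltn_pmod.
have td : (t < d)%N by rewrite ltnNge; apply/negP => dt;
  have := leq_mul dt (leqnn m); lia.
have qd : (1 <= d - t <= d)%N by lia.
have := H _ qd; rewrite xiE //.
have E1 : ((d - t) * m + t * m = n)%N by rewrite -mulnDl subnK // ltnW.
have E2 : ((d - t - 1) * m + m = (d - t) * m)%N.
  by rewrite -[X in (_ + X)%N]mul1n -mulnDl subnK //; lia.
by lia.
Qed.

Lemma in_MP f : in_M f <-> increasing f /\
  forall d v, (d %| n)%N -> is_bval v -> (forall x, h d x -> v x) ->
    (n %/ d %| cnt v f)%N.
Proof.
split=> -[incf H]; split=> //.
  by move=> d v dn vP hv; apply/(bval_xiP vP incf dn) => q qd; apply/hv/H.
move=> d q dn qd; apply: contrapT => /bval_exists[v [vP hv /negP]]; apply.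
exact: (bval_xiP vP incf dn).2 (H d v dn vP hv) q qd.
Qed.

Lemma in_M_fone : in_M fone.
Proof.
apply/in_MP; split=> [|d v dn vP _]; first exact: increasing_fone.
by rewrite cnt_fone // dvdn_div.
Qed.

Lemma in_M_fneg f : in_M f -> in_M (fneg f).
Proof.
move=> /in_MP[incf H]; apply/in_MP; split=> [|d v dn vP hv].
  exact: increasing_fneg.
by rewrite cnt_fneg //; apply: dvdn_sub; [apply: dvdn_div | apply: H].
Qed.

Lemma in_M_fimp f g : in_M f -> in_M g -> in_M (fimp f g).
Proof.
move=> /in_MP[incf Hf] /in_MP[incg Hg]; apply/in_MP.
split=> [|d v dn vP hv]; first exact: increasing_fimp.
rewrite cnt_fimp // /minn; case: ifP => _; first by rewrite dvdn_div.
apply: dvdn_add; last exact: Hg.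
by apply: dvdn_sub; [apply: dvdn_div | apply: Hf].
Qed.

Lemma M_in_M (a : M) : in_M (val a).
Proof. exact/asboolP/(valP a). Qed.

Definition M_one : M := Sub fone (asboolT in_M_fone).
Definition M_neg (a : M) : M := Sub (fneg (val a)) (asboolT (in_M_fneg (M_in_M a))).
Definition M_imp (a b : M) : M :=
  Sub (fimp (val a) (val b)) (asboolT (in_M_fimp (M_in_M a) (M_in_M b))).

Let M_inc (a : M) : increasing (val a).
Proof. by have [] := M_in_M a. Qed.

Let M_eq (a b : M) :
  (forall v, is_bval v -> cnt v (val a) = cnt v (val b)) -> a = b.
Proof. by move=> H; apply/val_inj/cnt_inj. Qed.

Let cnt_one v : is_bval v -> cnt v (val M_one) = n.
Proof. exact: cnt_fone. Qed.
Let cnt_neg v a : is_bval v -> cnt v (val (M_neg a)) = (n - cnt v (val a))%N.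
Proof. by move=> vP; apply: cnt_fneg. Qed.
Let cnt_imp v a b : is_bval v ->
  cnt v (val (M_imp a b)) = minn n (n - cnt v (val a) + cnt v (val b)).
Proof. by move=> vP; apply: cnt_fimp. Qed.

Let M1 (a : M) : M_imp M_one a = a.
Proof.
apply: M_eq => v vP; rewrite cnt_imp // cnt_one //.
by have := cnt_le v (val a); lia.
Qed.
Let MT (a b c : M) :
  M_imp (M_imp a b) (M_imp (M_imp b c) (M_imp a c)) = M_one.
Proof.
apply: M_eq => v vP; rewrite !cnt_imp // cnt_one //.
by have := cnt_le v (val a); have := cnt_le v (val b);
  have := cnt_le v (val c); lia.
Qed.
Let MC (a b : M) : M_imp (M_imp a b) b = M_imp (M_imp b a) a.
Proof.
apply: M_eq => v vP; rewrite !cnt_imp //.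
by have := cnt_le v (val a); have := cnt_le v (val b); lia.
Qed.
Let MN (a b : M) : M_imp (M_imp (M_neg b) (M_neg a)) (M_imp a b) = M_one.
Proof.
apply: M_eq => v vP; rewrite !cnt_imp // !cnt_neg // cnt_one //.
by have := cnt_le v (val a); have := cnt_le v (val b); lia.
Qed.

HB.instance Definition _ := isWajsberg.Build M M1 MT MC MN.

End RepresentingAlgebra.

(* mu is a Boolean isomorphism of B onto the Boolean subalgebra B(A) of A. *)
Definition is_boolean_iso (disp : Order.disp_t) (B : ctbDistrLatticeType disp)
    (A : wajsbergType) (mu : B -> A) : Prop :=
  set_bij [set: B]%classic (boolean_center A) mu /\
  [/\ mu \bot = wzero A,
      mu \top = wone,
      forall x, mu (~` x) = wneg (mu x),
      forall x y, mu (x `&` y) = wmeet (mu x) (mu y) &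
      forall x y, mu (x `|` y) = wjoin (mu x) (mu y)].

(* Main.v *)
Require Import Defs.
From mathcomp Require Import all_boot all_order all_algebra.
From mathcomp Require Import zify lra.
From mathcomp Require Import boolp classical_sets functions.

(** A Boolean valuation [v] of [B] sends [a : M n h] to [cnt v a], which counts
the indices where [v (a k)] holds, and [a |-> cnt v a / n] is a homomorphism
into the Lukasiewicz chain. Boolean elements are those whose counts are all
[0] or [n], i.e. the constant functions; this gives [mu].

If [x] is not in [h d], a valuation [v] containing [h d] with [v x] false yields
a prime filter [{a | cnt v a = n}] whose quotient embeds in [L_(d+1)] and which
omits [mu x]. Conversely, a prime filter [P] omitting [mu x] induces a valuation
[v] of [B], and by the gcd condition the divisors [s] with [h s] contained in [v]
are the multiples of a least one, [r]. Some [a] in [M n h] has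
[cnt v a = n / r]; its image in any chain containing the quotient by [P] is
[1 / r], so an embedding in [L_(d+1)] forces [r %| d], hence [h d] is contained
in [v] and [x] is not in [h d]. *)

Set Implicit Arguments.
Unset Strict Implicit.
Unset Printing Implicit Defensive.

Import Order.TTheory Order.CTheory GRing.Theory Num.Theory.

(** * Step functions and their counts *)

Section StepFunctions.
Variables (disp : Order.disp_t) (B : ctbDistrLatticeType disp) (n : nat).

(** With [c = n] this gives the constants of the Boolean center, with [c = n %/ r] the elements that
    act as [1 / r]. *)
Definition step_fun (c : nat) (z : B) : {ffun 'I_n -> B} :=
  [ffun k : 'I_n => if (n - c <= k)%N then z else \bot%O].

Lemma increasing_step_fun c z : increasing (step_fun c z).
Proof.
move=> i j ij; rewrite !ffunE.
by case: ifP => [ci|_]; rewrite ?le0x // (leq_trans ci ij).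
Qed.

Lemma cnt_step_fun v c z : is_bval v -> (c <= n)%N ->
  cnt v (step_fun c z) = if v z then c else 0%N.
Proof.
move=> vP cn; apply: (cnt_uniq vP (increasing_step_fun c z)).
  by case: ifP.
move=> k kn; have [i Ei ->] := evE (step_fun c z) kn.
rewrite ffunE Ei; case: ifP => ci; case: ifP => vz; rewrite ?vz ?bval0 //; lia.
Qed.

End StepFunctions.

(** The elements where [v] holds form a filter, one of those intersected in [bfilter_gen]. *)
Lemma bval_filter_gen disp (B : ctbDistrLatticeType disp) (v : B -> bool)
    (S : set B) :
  is_bval v -> (forall x, S x -> v x) -> forall x, bfilter_gen S x -> v x.
Proof.
move=> vP Sv x.
have up a b : (a <= b)%O -> v a -> v b by apply: bval_le.
have cap a b : v a -> v b -> v (a `&` b)%O by rewrite bvalI // => -> ->.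
by apply: (_ : bfilter_gen_set S x -> BFilter (bvalT vP) up cap x); apply.
Qed.

(** * Truncated multiples and unit fractions in the chain *)

(* [wneg a ==>> b] is the truncated sum of [a] and [b]. *)
Definition wmuln (C : wajsbergType) (k : nat) (a : C) : C :=
  iter k (fun b => (wneg a ==>> b)%W) (wzero C).

Lemma luk_wmuln d k (t : luk d) :
  (val (wmuln k t) = Num.min 1 (k%:R * val t))%R.
Proof.
have /andP[/andP[t0 t1] _] := valP t; elim: k => [|k IH].
  rewrite mul0r min_r ?ler01 // /wmuln /=; lra.
rewrite /wmuln iterS -/(wmuln k t) -natr1 mulrDl mul1r.
rewrite [LHS](_ : _ = Num.min 1 (1 - (1 - val t) + val (wmuln k t)))%R // IH.
have k0 : (0 <= k%:R * val t :> rat)%R by rewrite mulr_ge0.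
move: (k%:R * val t)%R (val t) k0 t0 t1 => u {IH}t u0 t0 t1.
by rewrite /Num.min; do !case: ifPn; lra.
Qed.

(* [(r - 1) t = 1 - t] pins down [t = 1 / r] in the rational chain. *)
Lemma luk_unit_fraction d r (t : luk d) : (0 < d)%N -> (0 < r)%N ->
  wmuln r.-1 t = wneg t -> (r %| d)%N.
Proof.
case: r => // r d_gt0 _ /(congr1 val); rewrite luk_wmuln.
rewrite (_ : val (wneg t) = 1 - val t)%R //.
have [k kd Et] := (lukP (val t) d_gt0).1 (valP t).
have /andP[/andP[t0 t1] _] := valP t; move=> E.
have dP : (0 < d%:R :> rat)%R by rewrite ltr0n.
have {}E : (r.+1%:R * val t = 1)%R.
  rewrite -natr1 mulrDl mul1r; move: E; have [->|tP] := eqVneq (val t) 0%R.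
    by rewrite mulr0 min_r ?ler01 //; lra.
  (* For [t > 0] the right side [1 - t] is below 1, so the minimum is not attained by 1 alone and
     [(r - 1) t = 1 - t] holds untruncated. *)
  have {tP}t0 : (0 < val t)%R by rewrite lt0r tP.
  move: (r%:R * val t)%R (val t) t0 t1 => u {Et}t t0 t1.
  by rewrite /Num.min; case: ifPn; lra.
(* Since [t = k / d], the equation [r t = 1] reads [r k = d]. *)
have : ((r.+1 * k)%N%:R = d%:R :> rat)%R.
  by move: E; rewrite natrM Et mulrA => /(canRL (divfK (lt0r_neq0 dP))) ->; rewrite mul1r.
by move=> /eqP; rewrite eqr_nat => /eqP <-; rewrite dvdn_mulr.
Qed.

Section RepresentingAlgebra.
Variables (n : nat) (disp : Order.disp_t) (B : ctbDistrLatticeType disp).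
Variable h : nat -> bfilter B.
Local Notation A := (M n h).
Implicit Types (a b : A) (x y : B).
Local Open Scope wajsberg_scope.

(** * Counts as homomorphisms on the algebra *)

Definition mcnt (v : B -> bool) a : nat := cnt v (val a).

Lemma M_increasing a : increasing (val a).
Proof. by have [] := M_in_M a. Qed.

Lemma mcnt_le v a : (mcnt v a <= n)%N.
Proof. exact: cnt_le. Qed.

Lemma mcnt_inj a b : (forall v, is_bval v -> mcnt v a = mcnt v b) -> a = b.
Proof. by move=> H; apply/val_inj/cnt_inj => //; apply: M_increasing. Qed.

Section Counts.
Variables (v : B -> bool) (vP : is_bval v).

Lemma mcnt1 : mcnt v (wone : A) = n.
Proof. exact: cnt_fone. Qed.

Lemma mcntN a : mcnt v (wneg a) = (n - mcnt v a)%N.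
Proof. exact: cnt_fneg vP (M_increasing a). Qed.

Lemma mcnt_imp a b :
  mcnt v (a ==>> b) = minn n (n - mcnt v a + mcnt v b).
Proof. exact: cnt_fimp vP (M_increasing a) (M_increasing b). Qed.

Lemma mcnt_impT a b : mcnt v (a ==>> b) = n <-> (mcnt v a <= mcnt v b)%N.
Proof.
by rewrite mcnt_imp; have := mcnt_le v a; have := mcnt_le v b; lia.
Qed.

Lemma mcnt0 : mcnt v (wzero A) = 0%N.
Proof. by rewrite mcntN mcnt1 subnn. Qed.

End Counts.

(** * Constant functions and the Boolean center *)

Lemma in_M_step_fun1 x : in_M h (step_fun n n x).
Proof.
apply/in_MP; split=> [|d v dn vP _]; first exact: increasing_step_fun.
by rewrite cnt_step_fun //; case: ifP; rewrite ?dvdn0 ?dvdn_div.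
Qed.

Definition mu x : A := Sub (step_fun n n x) (asboolT (in_M_step_fun1 x)).

Lemma mcnt_mu v x : is_bval v -> mcnt v (mu x) = if v x then n else 0%N.
Proof. by move=> vP; apply: cnt_step_fun. Qed.

Lemma mu_imp x y : mu x ==>> mu y = mu (~` x `|` y)%O.
Proof.
apply: mcnt_inj => v vP; rewrite mcnt_imp // !mcnt_mu // bvalU // bvalC //.
by case: (v x); case: (v y) => /=; lia.
Qed.

Lemma muT : mu \top%O = wone.
Proof. by apply: mcnt_inj => v vP; rewrite mcnt_mu // bvalT // mcnt1. Qed.

Lemma muC x : mu (~` x)%O = wneg (mu x).
Proof.
apply: mcnt_inj => v vP; rewrite mcntN // !mcnt_mu // bvalC //.
by case: (v x) => /=; lia.
Qed.

Lemma mu_center x : boolean_center A (mu x).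
Proof.
apply: mcnt_inj => v vP; rewrite !(mcntN, mcnt_imp, mcnt_mu) //.
by case: (v x); lia.
Qed.

(** If [a] has count [c], then [wodot a a] has count [max(0, 2c - n)], which equals [c] only at the
    two ends. *)
Lemma mcnt_center v a : is_bval v -> boolean_center A a ->
  mcnt v a = 0%N \/ mcnt v a = n.
Proof.
move=> vP /(congr1 (mcnt v)); rewrite !(mcntN, mcnt_imp) //.
by have := mcnt_le v a; lia.
Qed.

Lemma mu_iso : (0 < n)%N -> is_boolean_iso mu.
Proof.
move=> n_gt0; split; first split.
- by move=> x _; apply: mu_center.
- move=> x y _ _ E; apply: bval_inj => v vP.
  have := congr1 (mcnt v) E; rewrite !mcnt_mu //.
  by case: (v x); case: (v y) => //; lia.
(* The value at the last index is the largest, so [v] holds there exactly when the count is nonzero,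
   that is, [n]. *)
- move=> a ca; exists (ev (val a) n) => //; apply: mcnt_inj => v vP.
  rewrite mcnt_mu // bval_ev ?n_gt0 ?leqnn //; last exact: M_increasing.
  by rewrite -/(mcnt v a); case: (mcnt_center vP ca) => ->; case: ifP; lia.
split=> [||x|x y|x y]; first by rewrite -compl1 muC muT.
- exact: muT.
- exact: muC.
- by rewrite /wmeet /wjoin -!muC !mu_imp -muC !(complU, complK, complI)
    meetUl meetCx joinx0.
- by rewrite /wjoin !mu_imp complU complK joinIl joinCx meetx1.
Qed.

(** * From valuations to prime filters *)

Section ValuationFilter.
Variables (v : B -> bool) (vP : is_bval v).

Definition val_filter : impl_filter A.
Proof.
apply: (@ImplFilter _ (fun a => mcnt v a = n)); first exact: mcnt1.
by move=> a b an; rewrite mcnt_impT // an; have := mcnt_le v b; lia.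
Defined.

Local Notation Q := (wquot val_filter).

Lemma val_filter_piP a b :
  \pi_Q%qT a = \pi_Q%qT b <-> mcnt v a = mcnt v b.
Proof.
rewrite wquot_eqP; split=> [[/mcnt_impT ab /mcnt_impT ba]|E].
  by apply/eqP; rewrite eqn_leq ab ?ba.
by split; apply/mcnt_impT; rewrite ?E.
Qed.

Lemma val_filter_prime : is_prime val_filter.
Proof.
move=> X Y; elim/quotW: X => a; elim/quotW: Y => b; rewrite /wle.
have piT c : mcnt v c = n -> \pi_Q%qT c = wone.
  by move=> cn; apply/val_filter_piP; rewrite mcnt1.
have [ab|/ltnW ba] := leqP (mcnt v a) (mcnt v b); [left|right];
  by rewrite [LHS]wquot_impE; apply/piT/mcnt_impT.
Qed.

(** A class is sent to [mcnt v a / n]; as [v] contains [h d], each count is some [t * (n %/ d)], and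
    the image is [t / d]. *)
Lemma val_filter_embeds d : (0 < n)%N -> (d %| n)%N ->
  (forall x, h d x -> v x) -> wembeds Q (luk d).
Proof.
move=> n_gt0 dn hv.
have nP : (0 < n%:R :> rat)%R by rewrite ltr0n.
have d_gt0 := dvdn_gt0 n_gt0 dn.
have inl a : in_luk d ((mcnt v a)%:R / n%:R)%R.
  have /in_MP[_ /(_ d v dn vP hv)/dvdnP[t Et]] := M_in_M a.
  have En : n = (d * (n %/ d))%N by rewrite mulnC divnK.
  have m_gt0 : (0 < n %/ d)%N by rewrite divn_gt0 // dvdn_leq.
  apply/lukP => //; exists t.
    by have := mcnt_le v a; rewrite /mcnt Et {2}En leq_pmul2r.
  have mP : ((n %/ d)%:R != 0 :> rat)%R by rewrite pnatr_eq0 -lt0n.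
  have -> : (n%:R = d%:R * (n %/ d)%:R :> rat)%R by rewrite -natrM -En.
  by rewrite /mcnt Et natrM -mulf_div divff // mulr1.
pose phi (X : Q) : luk d := Sub _ (inl (repr X)).
have cr a : mcnt v (repr (\pi_Q%qT a)) = mcnt v a.
  by apply/val_filter_piP; rewrite reprK.
exists phi; split.
- move=> X Y; elim/quotW: X => a; elim/quotW: Y => b /(congr1 val) /=.
  rewrite !cr => /(divIf (lt0r_neq0 nP)) /eqP; rewrite eqr_nat => /eqP E.
  exact/val_filter_piP.
- by apply/val_inj; rewrite /= cr mcnt1 // divff // gt_eqF.
- elim/quotW=> a; apply/val_inj; rewrite /= [wneg _]wquot_negE !cr mcntN //.
  by rewrite natrB ?mcnt_le // mulrBl divff // gt_eqF.
elim/quotW=> a; elim/quotW=> b; apply/val_inj.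
rewrite /= [_ ==>> _]wquot_impE !cr mcnt_imp //.
have an := mcnt_le v a.
have E : ((n - mcnt v a + mcnt v b)%:R / n%:R =
    1 - (mcnt v a)%:R / n%:R + (mcnt v b)%:R / n%:R :> rat)%R.
  by rewrite natrD natrB // mulrDl mulrBl divff // gt_eqF.
rewrite -E /minn; case: leqP => [|/ltnW] le.
  by apply/esym/min_idPr; rewrite ler_pdivrMr // mul1r ler_nat.
rewrite divff ?gt_eqF //; apply/esym/min_idPl.
by rewrite ler_pdivlMr // mul1r ler_nat.
Qed.

End ValuationFilter.

Lemma hA_mu_sub d x : (0 < n)%N -> (d %| n)%N -> hA A d (mu x) -> h d x.
Proof.
move=> n_gt0 dn [Px _]; apply: contrapT => /bval_exists[v [vP hv vx]].
have := Px (val_filter vP) (@val_filter_prime v vP) (val_filter_embeds vP n_gt0 dn hv).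
by rewrite /= mcnt_mu // (negPf vx); lia.
Qed.

(** * From prime filters to valuations *)

Section PrimeFilter.
Variables (P : impl_filter A) (P_prime : is_prime P).

Lemma filter_le a b : wle a b -> P a -> P b.
Proof. by move=> ab Pa; apply: (impl_filter_mp Pa); rewrite ab; apply: impl_filter1. Qed.

Definition filter_bval x : bool := `[< P (mu x) >].

Lemma filter_bvalP : ~ P (mu \bot%O) -> is_bval filter_bval.
Proof.
move=> P0.
have up x y : (x <= y)%O -> P (mu x) -> P (mu y).
  move=> xy; apply: filter_le; rewrite /wle mu_imp -muT; congr mu.
  by apply/eqP; rewrite -le1x -(joinCx x) leU2.
have cap x y : P (mu x) -> P (mu y) -> P (mu (x `&` y)%O).
  move=> Px Py; apply: (impl_filter_mp Py); rewrite mu_imp joinIr joinCx meetx1.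
  by apply: up Px; rewrite leUr.
split=> [|x y|x].
- by apply/asboolP; rewrite muT; apply: impl_filter1.
- apply/asboolP/andP => [Pxy|[/asboolP Px /asboolP Py]]; last exact: cap.
  by split; apply/asboolP; apply: up Pxy; rewrite ?leIl ?leIr.
- apply/asboolP/negP => [Pcx /asboolP Px|nPx].
    by apply: P0; rewrite -(meetxC x); apply: cap.
  have {nPx} Px : ~ P (mu x) by move=> Px; apply/nPx/asboolP.
  (* The images of [x] and its complement are comparable, and [mu x ==>> mu (~] x)[is just]mu
     (~[x)], and symmetrically; so [P] contains one of the two. *)
  have := P_prime (\pi_(wquot P)%qT (mu x)) (\pi_(wquot P)%qT (mu (~` x)%O)).
  case; rewrite /wle [_ ==>> _]wquot_impE mu_imp ?complK joinxx;
    by case/wquot_eqP=> _; rewrite wimp1x.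
Qed.

(** The constant function at the least value of [a] lies below [a], and a full count puts that
    constant in [P]. *)
Lemma mcnt_filter a : (0 < n)%N -> is_bval filter_bval ->
  mcnt filter_bval a = n -> P a.
Proof.
move=> n_gt0 vP an; have n1 : (0 < 1 <= n)%N by rewrite n_gt0.
have /asboolP : filter_bval (ev (val a) 1).
  rewrite bval_ev //; first by rewrite -/(mcnt _ a) an; lia.
  exact: M_increasing.
apply: filter_le; apply: mcnt_inj => w wP; rewrite mcnt1 // mcnt_impT //.
rewrite mcnt_mu // bval_ev //; last exact: M_increasing.
by rewrite -/(mcnt w a); case: ifP; lia.
Qed.

End PrimeFilter.

Lemma mcnt_wmuln v k a : is_bval v ->
  mcnt v (wmuln k a) = minn n (k * mcnt v a).
Proof.
move=> vP; elim: k => [|k IH]; first by rewrite mcnt0 // mul0n minn0.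
rewrite /wmuln iterS -/(wmuln k a) mcnt_imp // mcntN // IH mulSn.
by have := mcnt_le v a; lia.
Qed.

(** The [(r - 1)]-fold sum of [a] and [wneg a] both have count [n - n / r], so they agree modulo
    [P]; the embedding carries this equation to the chain. *)
Lemma wembeds_unit_fraction (P : impl_filter A) d r a :
    (0 < n)%N -> (0 < d)%N -> (r %| n)%N ->
    wembeds (wquot P) (luk d) -> is_bval (filter_bval P) ->
    mcnt (filter_bval P) a = (n %/ r)%N ->
  (r %| d)%N.
Proof.
move=> n_gt0 d_gt0 rn [phi [_ phi1 phiN phiI]] vP cta.
have r_gt0 := dvdn_gt0 n_gt0 rn.
set pi := \pi_(wquot P)%qT.
have piN b : phi (pi (wneg b)) = wneg (phi (pi b)).
  by rewrite -phiN [wneg (pi b)]wquot_negE.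
have piM k b : phi (pi (wmuln k b)) = wmuln k (phi (pi b)).
  elim: k => [|k IH]; first by rewrite /= piN [phi (pi wone)]phi1.
  by rewrite /wmuln !iterS -!/(wmuln k _) -IH -piN -phiI [pi _ ==>> pi _]wquot_impE.
apply: (@luk_unit_fraction d r (phi (pi a))) => //.
rewrite -piM -piN; congr phi.
have Ec : mcnt (filter_bval P) (wmuln r.-1 a) = mcnt (filter_bval P) (wneg a).
  rewrite mcnt_wmuln // mcntN // cta.
  by case: (r) r_gt0 (divnK rn) => // r' _ /=; move: (n %/ _)%N => m; nia.
by apply/wquot_eqP; split; apply: mcnt_filter => //; apply/mcnt_impT; rewrite ?Ec.
Qed.

(** * Divisors whose filter lies in a valuation *)

Section LeastDivisor.
Hypothesis n_gt0 : (0 < n)%N.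
Hypothesis h_n : bfilter_set (h n) = [set (\top : B)%O]%classic.
Hypothesis h_gcd : forall d r : nat, (d %| n)%N -> (r %| n)%N ->
  bfilter_set (h (gcdn d r)) = bfilter_set (bfilter_join (h d) (h r)).
Variables (v : B -> bool) (vP : is_bval v).

Let below s := forall x, h s x -> v x.

Lemma least_divisor : exists2 r, (r %| n)%N &
  forall s, (s %| n)%N -> below s <-> (r %| s)%N.
Proof.
pose p s := (s %| n)%N && `[< below s >].
have exp : exists s, p s.
  exists n; rewrite /p dvdnn; apply/asboolP => x.
  by rewrite h_n => ->; apply: bvalT.
have [r /andP[rn /asboolP hr] rmin] := ex_minnP exp.
have r_gt0 := dvdn_gt0 n_gt0 rn.
exists r => // s sn; split=> [hs|rs].
  (* A valuation containing [h r] and [h s] contains their join, so minimality of [r] gives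
     [r <= gcdn r s]. *)
  have : p (gcdn r s).
    rewrite /p (dvdn_trans (dvdn_gcdl r s) rn); apply/asboolP => x.
    rewrite h_gcd //; apply: bval_filter_gen => // y [/hr|/hs] //.
  move=> /rmin le; apply/gcdn_idPl/eqP.
  by rewrite eqn_leq le dvdn_leq // dvdn_gcdl.
(* For [r %| s], [h r] is the join of [h r] and [h s], so it contains [h s]. *)
by move=> x hx; apply: hr; rewrite -(gcdn_idPl rs) h_gcd // => F; apply; right.
Qed.

(* [z] meets the complements of witnesses that [h s] is not contained in [v],
   for [s] not a multiple of [r]: the count at a valuation containing such an
   [h s] is then [0], which every [n %/ s] divides. *)
Lemma unit_fraction_exists r : (r %| n)%N ->
    (forall s, (s %| n)%N -> below s -> (r %| s)%N) ->
  exists a : A, mcnt v a = (n %/ r)%N.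
Proof.
move=> rn hr.
have /choice[w wP] s : exists x : B, (s %| n)%N -> ~~ (r %| s)%N -> h s x /\ ~~ v x.
  have [sn|sn] := boolP (s %| n)%N; last by exists \top%O.
  have [rs|rs] := boolP (r %| s)%N; first by exists \top%O.
  have [x /not_implyP[hx /negP vx]] : exists x, ~ (h s x -> v x).
    by apply/existsNP => hs; move/negP: rs; apply; apply: hr.
  by exists x.
pose z := (\meet_(s <- [seq s <- divisors n | ~~ (r %| s)%N]) ~` w s)%O.
have vz : v z.
  rewrite bval_meet //; apply/allP => s; rewrite mem_filter -dvdn_divisors //.
  by case/andP => rs sn; rewrite bvalC //; have [] := wP s sn rs.
have rlen : (n %/ r <= n)%N by apply: leq_div.
have inz : in_M h (step_fun n (n %/ r) z).
  apply/in_MP; split=> [|s u sn uP hu]; first exact: increasing_step_fun.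
  rewrite cnt_step_fun //; case: ifP => [uz|_]; last exact: dvdn0.
  have [rs|rs] := boolP (r %| s)%N.
    (* Here [n / r = (n / s) * (s / r)]. *)
    have [t Es] := dvdnP rs.
    have /dvdnP[m En] := sn.
    have s_gt0 := dvdn_gt0 n_gt0 sn.
    have r_gt0 := dvdn_gt0 n_gt0 rn.
    by rewrite {1}En mulnK // En Es mulnA mulnK // dvdn_mulr.
  have [hw _] := wP s sn rs.
  have := uz; rewrite bval_meet // => /allP/(_ s).
  by rewrite mem_filter rs -dvdn_divisors // bvalC // (hu _ hw) => /(_ sn).
exists (Sub (step_fun n (n %/ r) z) (asboolT inz)).
by rewrite /mcnt /= cnt_step_fun // vz.
Qed.

End LeastDivisor.

End RepresentingAlgebra.

Theorem theorem3 (n : nat) (n_gt0 : (0 < n)%N)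
    (disp : Order.disp_t) (B : ctbDistrLatticeType disp)
    (h : nat -> bfilter B)
    (h_n : bfilter_set (h n) = [set (\top : B)%O]%classic)
    (h_gcd : forall d r : nat, (d %| n)%N -> (r %| n)%N ->
       bfilter_set (h (gcdn d r)) = bfilter_set (bfilter_join (h d) (h r))) :
  exists mu : B -> M n h,
    is_boolean_iso mu /\
    forall d : nat, (d %| n)%N ->
      (mu @^-1` hA (M n h) d)%classic = bfilter_set (h d).
Proof.
exists (@mu n _ B h); split=> [|d dn]; first exact: mu_iso.
apply/seteqP; split=> x; first exact: hA_mu_sub.
move=> hx; split; last exact: mu_center.
move=> P P_prime emb; apply: contrapT => Px.
have vP : is_bval (filter_bval P).
  (* As [mu \bot] lies below [mu x], a filter omitting [mu x] omits [mu \bot]. *)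
  apply: filter_bvalP => // P0; apply: Px; apply: filter_le P0.
  by rewrite /wle mu_imp compl0 join1x muT.
have [r rn hr] := least_divisor n_gt0 h_n h_gcd vP.
have [a ca] := unit_fraction_exists n_gt0 vP rn (fun s sn => (hr s sn).1).
have /(hr d dn) hv := wembeds_unit_fraction n_gt0 (dvdn_gt0 n_gt0 dn) rn emb vP ca.
by have /asboolP := hv x hx.
Qed.
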